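(* Let $F=(F_1,\dots,F_m)$ with $F_i=f_i+g_i$ be as in the context (with $f_i$ having Hölder continuous gradient on $\operatorname{dom}F$ with exponent $\nu_i\in(0,1]$ and coefficient $M_i>0$). Let $\varepsilon>0$, $x^0\in\operatorname{dom}F$, $\ell_{-1}\ge 2$, and let $\{x^k\}_{k\ge0}$ and $\{\ell_k\}_{k\ge -1}$ be generated by the backtracking proximal gradient method (Algorithm 1) described in the context. Then for every integer $K\ge 1$ satisfying $$K \;\ge\; \max\left\{2\ell_{-1}\varepsilon^{-1},\ \max_{1\le i\le m} 4\left(\frac{1-\nu_i}{1+\nu_i}\right)^{\frac{1-\nu_i}{2\nu_i}}\varepsilon^{-\frac{1+\nu_i}{2\nu_i}}M_i^{\frac1{\nu_i}}\right\}u_0(x^0),$$ we have $$\min_{0\le k\le K-1}\ell_k\,w_{\ell_k}(x^k)\le\varepsilon .$$ Moreover, with $\nu_{\min}=\min_{1\le i\le m}\nu_i$, the right-hand side of the lower bound on $K$ is (for fixed problem data, $x^0$ with $u_0(x^0)<\infty$, and $\ell_{-1}$) of order $O\left(\varepsilon^{-\frac{1+\nu_{\min}}{2\nu_{\min}}}\right)$ as $\varepsilon\downarrow0$.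
   Context: Setting. Let $m,n\ge1$ be integers and $\|\cdot\|$ the Euclidean norm on $\mathbb{R}^n$. For $i=1,\dots,m$ let $F_i=f_i+g_i:\mathbb{R}^n\to\mathbb{R}\cup\{+\infty\}$, where $f_i:\mathbb{R}^n\to\mathbb{R}$ is continuously differentiable and $g_i:\mathbb{R}^n\to\mathbb{R}\cup\{+\infty\}$ is proper, lower semicontinuous and convex. Let $F=(F_1,\dots,F_m)$ and $\operatorname{dom}F=\{x\in\mathbb{R}^n: F_i(x)<+\infty\ \text{for all } i\}$, assumed nonempty (it is convex). For each $i$ there are $\nu_i\in(0,1]$ and $M_i>0$ with $\|\nabla f_i(x)-\nabla f_i(y)\|\le M_i\|x-y\|^{\nu_i}$ for all $x,y\in\operatorname{dom}F$. Convention: $0^0=1$, so that $\left(\frac{1-\nu_i}{1+\nu_i}\right)^{\frac{1-\nu_i}{2\nu_i}}=1$ when $\nu_i=1$. Merit functions. For $\ell>0$ and $x\in\operatorname{dom}F$, $$w_\ell(x)=\max_{y\in\mathbb{R}^n}\left[\min_{1\le i\le m}\{\nabla f_i(x)^\top(x-y)+g_i(x)-g_i(y)\}-\frac{\ell}{2}\|y-x\|^2\right],$$ $$d_\ell(x)=\operatorname*{argmin}_{d\in\mathbb{R}^n}\left[\max_{1\le i\le m}\{\nabla f_i(x)^\top d+g_i(x+d)-g_i(x)\}+\frac{\ell}{2}\|d\|^2\right]$$ (the minimizer exists and is unique, and the minimum value equals $-w_\ell(x)$), and $$u_0(x)=\sup_{y\in\mathbb{R}^n}\min_{1\le i\le m}\left(F_i(x)-F_i(y)\right)\in[0,\infty].$$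 Algorithm 1. Input: $x^0\in\operatorname{dom}F$, $\varepsilon>0$, $\ell_{-1}\ge2$. For $k=0,1,2,\dots$: the trial values of $\ell$ are, in order, $\ell=2^{j}\max\{1,\ell_{k-1}/2\}$, $j=0,1,2,\dots$. For each trial value $\ell$ put $d^k=d_\ell(x^k)$ and $x^{k+1}=x^k+d^k$, and test the condition $$F_i(x^{k+1})-F_i(x^k)\le -w_\ell(x^k)+\frac{\varepsilon}{2\ell}\quad\text{for all } i=1,\dots,m.$$ Stop at the first trial value $\ell$ for which the condition holds; set $\ell_k=\ell$, keep the corresponding $x^{k+1}=x^k+d_{\ell_k}(x^k)$, and go to the next $k$. *)

(* Defs.v *)
From HB Require Import structures.
From mathcomp Require Import all_boot all_order all_algebra.
From mathcomp Require Import all_classical all_reals all_analysis.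

Set Implicit Arguments.
Unset Strict Implicit.
Unset Printing Implicit Defensive.

Import Order.TTheory GRing.Theory Num.Theory.
Import numFieldNormedType.Exports.

Local Open Scope classical_set_scope.
Local Open Scope ring_scope.

Section Euclidean.
Context {R : realType} {n : nat}.
Implicit Types (u v x y : 'rV[R]_n).

(* The canonical norm of 'rV[R]_n is the sup norm, so the Euclidean one is
   defined here. Both induce the same topology, hence the library notions of
   differentiability, continuity and lower semicontinuity apply unchanged. *)
Definition dotv u v : R := \sum_j u ord0 j * v ord0 j.
Definition enorm u : R := Num.sqrt (dotv u u).

Definition grad (f : 'rV[R]_n -> R) x : 'rV[R]_n :=
  \row_j 'D_(delta_mx ord0 j) f x.

Definition continuously_differentiable (f : 'rV[R]_n -> R) : Prop :=
  (forall x, differentiable f x) /\ continuous (grad f).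

Local Open Scope ereal_scope.

Definition proper_fun (g : 'rV[R]_n -> \bar R) : Prop :=
  (forall x, g x != -oo) /\ (exists x, g x < +oo).

(* The end points t = 0 and t = 1 are harmless because 0 * +oo = 0. *)
Definition convex_efun (g : 'rV[R]_n -> \bar R) : Prop :=
  forall x y (t : R), (0 <= t <= 1)%R ->
    g (t *: x + (1 - t) *: y)%R <= t%:E * g x + (1 - t)%:E * g y.

End Euclidean.

Section Problem.
Context {R : realType} {m n : nat}.
Variables (f : 'I_m -> 'rV[R]_n -> R) (g : 'I_m -> 'rV[R]_n -> \bar R).
Implicit Types (x y d : 'rV[R]_n) (l eps : R).

Local Open Scope ereal_scope.

Definition objF (i : 'I_m) x : \bar R := (f i x)%:E + g i x.

Definition domF : set 'rV[R]_n := [set x | forall i, objF i x < +oo].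

(* The defaults +oo and -oo of the iterated min and max below are the neutral
   elements; they play no role when m > 0. *)

(* For l > 0 and x in domF the supremum is finite and attained. *)
Definition meritw l x : \bar R :=
  ereal_sup (range (fun y =>
    \big[mine/+oo]_(i < m) ((dotv (grad (f i) x) (x - y)%R)%:E + g i x - g i y)
    - (l / 2 * enorm (y - x) ^+ 2)%:E)).

Definition prox_obj l x d : \bar R :=
  \big[maxe/-oo]_(i < m)
    ((dotv (grad (f i) x) d)%:E + g i (x + d)%R - g i x)
  + (l / 2 * enorm d ^+ 2)%:E.

(* For l > 0 and x in domF there is exactly one minimizer. *)
Definition dirl l x : 'rV[R]_n :=
  get [set d | forall d', prox_obj l x d <= prox_obj l x d'].

Definition merit0 x : \bar R :=
  ereal_sup (range (fun y => \big[mine/+oo]_(i < m) (objF i x - objF i y))).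

Definition accepted eps l x : Prop :=
  forall i, objF i (x + dirl l x)%R - objF i x
            <= - meritw l x + (eps / (2 * l))%:E.

Local Close Scope ereal_scope.

(* The sequence (l_k) starts at k = -1; its first term is the separate lm1. *)
Definition prev_l (lm1 : R) (ls : nat -> R) (k : nat) : R :=
  if k is k'.+1 then ls k' else lm1.

Definition trial (lprev : R) (j : nat) : R := 2 ^+ j * Num.max 1 (lprev / 2).

Definition generated eps (x0 : 'rV[R]_n) (lm1 : R)
    (xs : nat -> 'rV[R]_n) (ls : nat -> R) : Prop :=
  xs 0%N = x0 /\
  forall k, exists j,
    [/\ ls k = trial (prev_l lm1 ls k) j,
        accepted eps (ls k) (xs k),
        (forall j', (j' < j)%N ->
           ~ accepted eps (trial (prev_l lm1 ls k) j') (xs k))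
      & xs k.+1 = xs k + dirl (ls k) (xs k)].

(* powR satisfies 0 `^ 0 = 1, which is the convention wanted for nu i = 1. *)
Definition iter_coef (nu M : 'I_m -> R) (lm1 eps : R) : R :=
  \big[Num.max/2 * lm1 * eps^-1]_(i < m)
    (4 * ((1 - nu i) / (1 + nu i)) `^ ((1 - nu i) / (2 * nu i))
       * eps `^ (- ((1 + nu i) / (2 * nu i))) * M i `^ (nu i)^-1).

Definition iter_bound (nu M : 'I_m -> R) (x0 : 'rV[R]_n) (lm1 eps : R) :
    \bar R :=
  ((iter_coef nu M lm1 eps)%:E * merit0 x0)%E.

End Problem.

(* The default 1 is neutral for exponents in ]0, 1]. *)
Definition nu_min (R : realType) (m : nat) (nu : 'I_m -> R) : R :=
  \big[Num.min/1]_(i < m) nu i.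

(* Main.v *)
Require Import Defs.
From HB Require Import structures.
From mathcomp Require Import all_boot all_order all_algebra.
From mathcomp Require Import all_classical all_reals all_analysis.
From mathcomp Require Import ring lra.

(** The method is a descent method with a uniform decrease per step. Suppose
    that [l_k * w_k > eps] in each of the first [K] iterations. The acceptance
    test lowers every objective by at least [w_k - eps / (2 * l_k)], which
    exceeds [eps / (2 * l_k)] ([accepted_decrease]). If all the [l_k] are at
    most [B], then after [K] steps every objective has dropped by more than
    [K * eps / (2 * B)], and the last iterate, used as a competitor in the
    definition of [merit0], gives [merit0 x0 > K * eps / (2 * B)]
    ([generated_invariant]). With [B = T * eps / 2], where [T] is the
    coefficient [iter_coef], this reads [T * merit0 x0 > K], against the choice
    of [K].

    The bound on the [l_k] comes from the fact that a rejected trial value lies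
    below some Holder threshold ([accepted_of_ge_threshold], [backtracking_le]).
    To see this, bound the increment of [f_i] along the proximal direction [d]
    by its linearization plus [M / (1 + nu) * |d| ^ (1 + nu)]
    ([holder_descent]), and absorb this last term by Young's inequality into
    [l / 2 * |d| ^ 2 + eps / (2 * l)] as soon as [l] is at least the threshold
    ([holder_le_quadratic]). What remains is the optimal value of the proximal
    model, which is at most [- w]. The terms of [iter_coef] are
    [4 / eps] times the thresholds, so that [B] is at least twice each of them.

    All this uses that [dirl] is a genuine minimizer of the proximal model
    ([dirl_min]). The model is lower semicontinuous, hence has a minimum on
    every ball. It is coercive because a lower semicontinuous convex function
    is bounded below on a ball and so, by convexity, decreases at most linearly
    away from it ([convex_lsc_linear_lower_bound]).

    The order of magnitude follows from the monotonicity of powers of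
    [eps < 1] in the exponent ([iter_coef_le_power]). *)

Set Implicit Arguments.
Unset Strict Implicit.
Unset Printing Implicit Defensive.

Import Order.TTheory GRing.Theory Num.Theory.
Import numFieldNormedType.Exports.

Local Open Scope classical_set_scope.
Local Open Scope ring_scope.

(** * Euclidean inner product and norm *)

Section EuclideanTheory.
Context {R : realType} {n : nat}.
Implicit Types (u v : 'rV[R]_n).

Lemma dotvC u v : dotv u v = dotv v u.
Proof. by apply: eq_bigr => j _; rewrite mulrC. Qed.

Lemma dotvDl u v w : dotv (u + v) w = dotv u w + dotv v w.
Proof. by rewrite -big_split; apply: eq_bigr => j _; rewrite mxE mulrDl. Qed.

Lemma dotvZl a u v : dotv (a *: u) v = a * dotv u v.
Proof. by rewrite mulr_sumr; apply: eq_bigr => j _; rewrite mxE mulrA. Qed.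

Lemma dotvNl u v : dotv (- u) v = - dotv u v.
Proof. by rewrite -scaleN1r dotvZl mulN1r. Qed.

Lemma dotvBl u v w : dotv (u - v) w = dotv u w - dotv v w.
Proof. by rewrite dotvDl dotvNl. Qed.

Lemma dotvZr a u v : dotv u (a *: v) = a * dotv u v.
Proof. by rewrite dotvC dotvZl dotvC. Qed.

Lemma dotv0r u : dotv u 0 = 0.
Proof. by rewrite -(scale0r 0) dotvZr mul0r. Qed.

Lemma dotvBr u v w : dotv w (u - v) = dotv w u - dotv w v.
Proof. by rewrite dotvC dotvBl !(dotvC w). Qed.

Lemma dotvv_ge0 u : 0 <= dotv u u.
Proof. by apply: sumr_ge0 => j _; rewrite -expr2 sqr_ge0. Qed.

Lemma enorm_sqr u : enorm u ^+ 2 = dotv u u.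
Proof. by rewrite sqr_sqrtr ?dotvv_ge0. Qed.

Lemma enorm_ge0 u : 0 <= enorm u.
Proof. exact: sqrtr_ge0. Qed.

Lemma enormZ a u : enorm (a *: u) = `|a| * enorm u.
Proof.
by rewrite /enorm dotvZl dotvZr mulrA -expr2 sqrtrM ?sqr_ge0// sqrtr_sqr.
Qed.

Lemma enorm_eq0 u : enorm u = 0 -> u = 0.
Proof.
move=> /eqP; rewrite -sqrf_eq0 enorm_sqr psumr_eq0; last first.
  by move=> j _; rewrite -expr2 sqr_ge0.
move=> /allP u0; apply/rowP => j; rewrite mxE.
have := u0 j; rewrite mem_index_enum => /(_ isT) /=.
by rewrite -expr2 sqrf_eq0 => /eqP.
Qed.

(** Cauchy-Schwarz: expand the square of [enorm v *: u - enorm u *: v]. *)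
Lemma dotv_le_enorm u v : dotv u v <= enorm u * enorm v.
Proof.
have [/enorm_eq0 ->|u0] := eqVneq (enorm u) 0.
  by rewrite dotvC dotv0r mulr_ge0 ?enorm_ge0.
have [/enorm_eq0 ->|v0] := eqVneq (enorm v) 0.
  by rewrite dotv0r mulr_ge0 ?enorm_ge0.
have uv0 : 0 < enorm u * enorm v by rewrite mulr_gt0// lt_def enorm_ge0 ?u0 ?v0.
rewrite -subr_ge0 -(pmulr_rge0 _ uv0) -(pmulr_rge0 _ (ltr0n R 2)).
have := dotvv_ge0 (enorm v *: u - enorm u *: v).
rewrite !(dotvBl, dotvBr, dotvZl, dotvZr) -!enorm_sqr (dotvC v u).
by move/le_trans; apply; rewrite le_eqVlt; apply/orP; left; apply/eqP; ring.
Qed.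

(** Compactness and growth at infinity are argued in the sup norm of the
    library; this comparison and the next one transfer the Euclidean terms of
    the proximal model to it. *)
Lemma norm_le_enorm u : `|u| <= enorm u.
Proof.
rewrite /Num.norm/=.
have [->|/mx_norm_neq0[[i j] /= ->]] := eqVneq (mx_norm u) 0.
  exact: enorm_ge0.
rewrite -sqrtr_sqr ler_wsqrtr// (ord1 i) /dotv (bigD1 j)//= expr2 lerDl.
by apply: sumr_ge0 => k _; rewrite -expr2 sqr_ge0.
Qed.

Lemma dotv_ge_norm (c u : 'rV[R]_n) : - ((\sum_j `|c ord0 j|) * `|u|) <= dotv c u.
Proof.
rewrite mulr_suml -sumrN; apply: ler_sum => j _.
rewrite -[leRHS]opprK lerN2 (le_trans (ler_norm _))// normrN normrM.
rewrite ler_wpM2l// {2}/Num.norm/= mx_normrE.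
by apply/bigmax_geP; right; exists (ord0, j).
Qed.

Lemma continuous_sumr {X : topologicalType} (h : 'I_n -> X -> R) :
  (forall j, continuous (h j)) -> continuous (fun x => \sum_j h j x).
Proof.
move=> ch x; elim: (index_enum _) => [|j r IH].
  by under eq_fun do rewrite big_nil; exact: cvg_cst.
under eq_fun do rewrite big_cons.
by apply: cvgD => //; exact: ch.
Qed.

Lemma continuous_dotv u : continuous (dotv u).
Proof.
apply: (@continuous_sumr _ (fun j v => u ord0 j * v ord0 j)) => j v.
by apply: continuousM; [exact: cst_continuous|exact: coord_continuous].
Qed.

Lemma continuous_enorm_sqr : continuous (fun u : 'rV[R]_n => enorm u ^+ 2).
Proof.
under eq_fun do rewrite enorm_sqr.
apply: (@continuous_sumr _ (fun j v => v ord0 j * v ord0 j)) => j v.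
by apply: continuousM; exact: coord_continuous.
Qed.

Lemma compact_norm_le (r : R) : compact [set u : 'rV[R]_n | `|u| <= r].
Proof.
apply: bounded_closed_compact.
  by exists r; split=> [|M rM u /= /le_trans]; [exact: num_real|apply; exact: ltW].
apply: (@preimage_closed _ _ (fun u : 'rV[R]_n => `|u|) [set s : R | s <= r]).
  by move=> u _; exact: norm_continuous.
exact: closed_le.
Qed.

End EuclideanTheory.

(** * Lower semicontinuous extended-real functions *)

Section LowerSemicontinuity.
Local Open Scope ereal_scope.

Lemma ereal_between {R : realType} (x y : \bar R) :
  x < y -> exists r : R, x < r%:E /\ r%:E < y.
Proof.
case: x => [a| |]; case: y => [b| |] //=.
- by rewrite lte_fin => ab; exists ((a + b) / 2)%R; rewrite !lte_fin; split; lra.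
- by move=> _; exists (a + 1)%R; rewrite ltry lte_fin ltrDl.
- by move=> _; exists (b - 1)%R; rewrite ltNyr lte_fin gtrDl oppr_lt0.
- by move=> _; exists 0%R; rewrite ltNyr ltry.
Qed.

Lemma lsc_addr_continuous {X : topologicalType} {R : realType}
    (phi : X -> \bar R) (psi : X -> R) :
  lower_semicontinuous phi -> continuous psi ->
  lower_semicontinuous (fun x => phi x + (psi x)%:E).
Proof.
move=> lphi cpsi x a; rewrite -lteBlDr// -EFinB => /ereal_between[b [ab bphi]].
rewrite lte_fin in ab.
have [V Vx Vphi] := lphi x b bphi.
exists (V `&` [set y | (a - b < psi y)%R]).
  apply: filterI => //; apply: (cpsi x (fun r => (a - b < r)%R)).
  by apply: lt_nbhsr; lra.
move=> y [Vy /= aby]; rewrite (_ : a = b + (a - b))%R; last by ring.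
by rewrite EFinD lteD// ?lte_fin// Vphi.
Qed.

Lemma lsc_comp {X Y : topologicalType} {R : realType}
    (phi : Y -> \bar R) (h : X -> Y) :
  lower_semicontinuous phi -> continuous h -> lower_semicontinuous (phi \o h).
Proof.
move=> lphi ch x a /= /lphi[V Vhx Vphi].
by exists (h @^-1` V); [exact: ch|move=> y; exact: Vphi].
Qed.

Lemma lsc_bigmax {X : topologicalType} {R : realType} (I : Type)
    (r : seq I) (phi : I -> X -> \bar R) :
  (forall i, lower_semicontinuous (phi i)) ->
  lower_semicontinuous (fun x => \big[maxe/-oo]_(i <- r) phi i x).
Proof.
move=> lphi; elim: r => [x a|i r IH x a]; first by rewrite big_nil.
rewrite big_cons lt_max => /orP[/lphi|/IH] [V Vx Vphi]; exists V => // y /Vphi;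
  by rewrite big_cons lt_max => ->; rewrite ?orbT.
Qed.

(** The sublevel sets of the values above the infimum generate a proper filter,
    and lower semicontinuity makes each of its cluster points a minimizer. *)
Lemma lsc_compact_min {X : topologicalType} {R : realType}
    (phi : X -> \bar R) (A : set X) :
  lower_semicontinuous phi -> compact A -> A !=set0 ->
  exists2 c, A c & forall y, A y -> phi c <= phi y.
Proof.
move=> lphi cA [x0 Ax0].
have [phiy|nphiy] := pselect (forall y, A y -> phi y = +oo).
  by exists x0 => // y Ay; rewrite !phiy.
have {nphiy} [x1 Ax1 phix1] : exists2 x, A x & phi x < +oo.
  apply: contrapT => H; apply: nphiy => y Ay; apply: contrapT => phiy.
  by apply: H; exists y; rewrite // ltey; exact/eqP.
set mu := ereal_inf (phi @` A).
have mule y : A y -> mu <= phi y by move=> Ay; apply: ereal_inf_lbound; exists y.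
pose D := [set a : R | mu < a%:E].
pose B (a : R) := A `&` [set y | phi y < a%:E].
have D0 : D !=set0.
  move: phix1 (mule _ Ax1); rewrite /D; case: (phi x1) => [s _ smu|//|_ smu].
    by exists (s + 1)%R; rewrite /= (le_lt_trans smu)// lte_fin ltrDl.
  by exists 0%R; rewrite /= (le_lt_trans smu)// ltNyr.
have FF : ProperFilter (filter_from D B).
  apply: filter_from_proper => [|a Da].
    apply: filter_from_filter => // a b Da Db; exists (Num.min a b).
      by rewrite /D /= EFin_min lt_min; apply/andP.
    move=> y [Ay]; rewrite /= EFin_min lt_min => /andP[? ?]; split; by split.
  have /ereal_inf_lt[_ [y Ay <-] phiya] : mu < a%:E by [].
  by exists y.
have [|p [Ap pF]] := cA _ FF.
  by case: D0 => a Da; exists a => // y [].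
exists p => // y Ay; apply: le_trans (mule _ Ay).
rewrite leNgt; apply/negP => mup.
have [a [mua ap]] := ereal_between mup.
have [V Vp Vphi] := lphi _ _ ap.
have [|z [[Az /= za] Vz]] := pF (B a) V _ Vp; first by exists a.
by have := Vphi z Vz; rewrite ltNge ltW.
Qed.

End LowerSemicontinuity.

(** * Descent inequality for a Holder continuous gradient *)

Section HolderDescent.
Context {R : realType} {n : nat}.
Implicit Types (f : 'rV[R]_n -> R) (x d : 'rV[R]_n).

Lemma derive_dotv_grad f x d :
  differentiable f x -> 'D_d f x = dotv (grad f x) d.
Proof.
move=> df; rewrite deriveE// [in LHS](row_sum_delta d) linear_sum.
by apply: eq_bigr => j _; rewrite linearZ/= mxE deriveE// mulrC.
Qed.

Lemma is_derive_line f x d (t : R) : differentiable f (x + t *: d) ->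
  is_derive t 1 (fun s : R => f (x + s *: d)) (dotv (grad f (x + t *: d)) d).
Proof.
move=> df; rewrite -derive_dotv_grad//.
(* Both derivatives are limits of the same difference quotient. *)
have quotE (h : R) :
    h^-1 *: ((f \o shift (x + t *: d)) (h *: d) - f (x + t *: d)) =
    h^-1 *: (((fun s => f (x + s *: d)) \o shift t) (h *: (1 : R))
             - f (x + t *: d)).
  by rewrite /= scalerDl addrCA [h *: (1 : R)]mulr1.
have : derivable f (x + t *: d) d by exact: diff_derivable.
split.
  by rewrite /derivable -(funext quotE).
by rewrite /derive -(funext quotE).
Qed.

(** Along the segment, the linearization error minus its claimed bound has a
    nonpositive derivative, by Cauchy-Schwarz and the Holder condition, and it
    vanishes at the start. Convexity of the domain of the objectives will
    provide the condition along the segment. *)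
Lemma holder_descent f (nu M : R) x d :
  (forall z, differentiable f z) -> 0 < nu ->
  (forall t : R, 0 < t < 1 ->
     enorm (grad f (x + t *: d) - grad f x) <= M * enorm (t *: d) `^ nu) ->
  f (x + d) - f x <= dotv (grad f x) d + M / (1 + nu) * enorm d `^ (1 + nu).
Proof.
move=> df nu0 hH.
have nu1 : 0 < 1 + nu by lra.
pose C := M / (1 + nu) * enorm d `^ (1 + nu).
pose phi (t : R) := f (x + t *: d) - dotv (grad f x) d * t - C * t `^ (1 + nu).
pose dphi (t : R) := dotv (grad f (x + t *: d)) d - dotv (grad f x) d
  - C * ((1 + nu) * t `^ nu).
have dphiP (t : R) : 0 < t -> is_derive t 1 phi (dphi t).
  move=> t0; have dl := is_derive_line (df (x + t *: d)).
  have dp := is_derive1_powR (1 + nu) t0.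
  apply: is_derive_eq (is_deriveB (is_deriveB dl (is_deriveZ
    (dotv (grad f x) d) (is_derive_id t 1))) (is_deriveZ C dp)) _.
  by rewrite /dphi [_ *: 1]mulr1 [1 + nu]addrC addrK.
have phi10 : phi 1 <= phi 0.
  have := @ler0_derive1_le_cc R phi 0 1.
  apply => //; rewrite ?in_itv/= ?lexx ?ler01//.
  - by move=> t; rewrite in_itv/= => /andP[t0 _]; have [] := dphiP t t0.
  - move=> t; rewrite in_itv/= => t01; have /andP[t0 _] := t01.
    rewrite derive1E; have -> := @derive_val _ _ _ _ _ _ _ (dphiP t t0).
    rewrite /dphi subr_le0 -dotvBl (le_trans (dotv_le_enorm _ _))//.
    rewrite (le_trans (ler_wpM2r (enorm_ge0 _) (hH t t01)))//.
    rewrite enormZ gtr0_norm// powRM ?enorm_ge0 ?(ltW t0)// le_eqVlt; apply/orP; left.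
    rewrite /C; have [->|d0] := eqVneq (enorm d) 0.
      by rewrite !powR0 ?lt0r_neq0// !(mulr0, mul0r).
    rewrite powRD ?d0 ?implybT// powRr1 ?enorm_ge0//.
    by apply/eqP; field; rewrite gt_eqF.
  - apply: derivable_oo_LRcontinuous_within; split.
    + by move=> t; rewrite in_itv/= => /andP[t0 _]; have [] := dphiP t t0.
    (* [t `^ (1 + nu)] equals 1 for [t < 0], so that at 0 only one-sided
       continuity holds. *)
    + apply: cvgB; last first.
        apply: cvgM; first exact: cvg_cst.
        by rewrite powR0 ?gt_eqF//; exact: powR_cvg0.
      have dl := is_derive_line (df (x + 0 *: d)).
      have [/derivable1_diffP/differentiable_continuous clin _] := is_deriveB dl
        (is_deriveZ (dotv (grad f x) d) (is_derive_id (0 : R) 1)).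
      exact: cvg_at_right_filter.
    + have [/derivable1_diffP/differentiable_continuous dphi1 _] := dphiP 1 ltr01.
      exact: cvg_at_left_filter.
move: phi10; rewrite /phi scale1r scale0r addr0 powR1 powR0 ?gt_eqF//.
by rewrite /C; lra.
Qed.

End HolderDescent.

(** * Step parameters that absorb the Holder term *)

Section Threshold.
Context {R : realType}.
Implicit Types (nu M eps l t : R).

(** The least [l] for which the Holder term of exponent [1 + nu] lies below
    [l / 2 * t ^+ 2 + eps / (2 * l)] for all [t]: equality in Young's inequality
    yields this constant. *)
Definition holder_threshold nu M eps : R :=
  M `^ nu^-1 * ((1 - nu) / (1 + nu)) `^ ((1 - nu) / (2 * nu))
    * eps `^ (- ((1 - nu) / (2 * nu))).

Lemma holder_thresholdE nu M eps : 0 < nu -> 0 < eps ->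
  4 * ((1 - nu) / (1 + nu)) `^ ((1 - nu) / (2 * nu))
    * eps `^ (- ((1 + nu) / (2 * nu))) * M `^ nu^-1
  = 4 * holder_threshold nu M eps / eps.
Proof.
move=> nu0 eps0; rewrite /holder_threshold.
have -> : - ((1 + nu) / (2 * nu)) = - ((1 - nu) / (2 * nu)) + -1.
  by field; rewrite gt_eqF.
rewrite powRD ?(gt_eqF eps0) ?implybT// powR_inv1 ?ltW//; ring.
Qed.

(** Young's inequality with weights [p = (1 + nu) / 2] and [q = (1 - nu) / 2],
    applied to [(l * t) ^+ 2] and to [eps / r] with [r = q / p]; the scaling by
    [r] turns the weighted mean into [p * ((l * t) ^+ 2 + eps)]. At [nu = 1] the
    weight [q] vanishes and the threshold is just [M]. *)
Lemma holder_le_quadratic nu M eps l t :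
  0 < nu <= 1 -> 0 < M -> 0 < eps -> 0 < l -> 0 <= t ->
  holder_threshold nu M eps <= l ->
  M / (1 + nu) * t `^ (1 + nu) <= l / 2 * t ^+ 2 + eps / (2 * l).
Proof.
move=> /andP[nu0]; rewrite le_eqVlt => /predU1P[->{nu nu0}|nu1] M0 eps0 l0 t0.
  rewrite /holder_threshold subrr !mul0r oppr0 !powRr0 invr1 powRr1 ?(ltW M0)// !mulr1.
  move=> Ml; rewrite -(natrD _ 1 1) powR_mulrn// -[leLHS]addr0 lerD//.
    by rewrite ler_wpM2r ?sqr_ge0// ler_wpM2r// invr_ge0.
  by rewrite divr_ge0 ?mulr_ge0 ?ltW.
move=> Ll.
pose r := (1 - nu) / (1 + nu); pose p := (1 + nu) / 2; pose q := (1 - nu) / 2.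
have r0 : 0 < r by rewrite divr_gt0; lra.
have p0 : 0 < p by rewrite divr_gt0; lra.
have q0 : 0 < q by rewrite divr_gt0; lra.
have s0 : 0 <= (l * t) ^+ 2 by rewrite sqr_ge0.
have er0 : 0 < eps / r by rewrite divr_gt0.
have lnu : M <= l `^ nu * (eps / r) `^ q.
  (* At the threshold itself the claim is an equality. *)
  have -> : M = holder_threshold nu M eps `^ nu * (eps / r) `^ q.
    rewrite /holder_threshold -/r; clearbody r.
    rewrite !powRM ?mulr_ge0 ?powR_ge0 ?invr_ge0 ?(ltW eps0) ?(ltW r0)//.
    rewrite -!powRrM mulVf ?lt0r_neq0// powRr1 ?(ltW M0)//.
    have -> : (1 - nu) / (2 * nu) * nu = q by rewrite /q; field; rewrite gt_eqF.
    have -> : - ((1 - nu) / (2 * nu)) * nu = - q.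
      by rewrite /q; field; rewrite gt_eqF.
    rewrite !powRN -(powR_inv1 (ltW r0)) -powRrM mulN1r powRN.
    by field; rewrite !lt0r_neq0 ?powR_gt0.
  rewrite ler_wpM2r ?powR_ge0// ge0_ler_powR ?nnegrE ?(ltW l0) ?(ltW nu0)//.
  by rewrite /holder_threshold !mulr_ge0 ?powR_ge0.
have young : ((l * t) ^+ 2) `^ p * (eps / r) `^ q <= p * ((l * t) ^+ 2 + eps).
  have := @conjugate_powR R (((l * t) ^+ 2) `^ p) ((eps / r) `^ q) p^-1 q^-1.
  rewrite !invrK -!powRrM !mulfV ?gt_eqF// !powRr1 ?(ltW er0)// => H.
  apply: (le_trans (H _ _ _ _ _)); rewrite ?powR_ge0 ?invr_gt0//.
    by rewrite /p /q; field.
  rewrite le_eqVlt; apply/orP; left; apply/eqP; rewrite /r /p /q.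
  by field; rewrite !gt_eqF//; lra.
have sp : ((l * t) ^+ 2) `^ p = l * l `^ nu * t `^ (1 + nu).
  rewrite -powR_mulrn ?mulr_ge0 ?(ltW l0)// -powRrM.
  have -> : 2%:R * p = 1 + nu by rewrite /p; field.
  by rewrite powRM ?(ltW l0)// powRD ?(gt_eqF l0) ?implybT// powRr1 ?(ltW l0).
have H : M * t `^ (1 + nu) * l <= p * ((l * t) ^+ 2 + eps).
  apply: le_trans young; rewrite sp -[leLHS]mulrA.
  rewrite [leRHS](_ : _ = l `^ nu * (eps / r) `^ q * (t `^ (1 + nu) * l));
    last by ring.
  by rewrite ler_wpM2r// mulr_ge0 ?powR_ge0 ?ltW.
have nu1p : 1 + nu != 0 by rewrite gt_eqF//; lra.
rewrite (_ : M / _ * _ = M * t `^ (1 + nu) * l / ((1 + nu) * l)); last first.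
  by field; rewrite nu1p gt_eqF.
rewrite [leRHS](_ : _ = p * ((l * t) ^+ 2 + eps) / ((1 + nu) * l)); last first.
  by rewrite /p; field; rewrite nu1p gt_eqF.
by rewrite ler_wpM2r// invr_ge0 mulr_ge0 ?ltW//; lra.
Qed.

End Threshold.

(** * Existence of the proximal direction *)

Section ConvexLsc.
Context {R : realType} {n : nat}.
Implicit Types (g : 'rV[R]_n -> \bar R) (x d : 'rV[R]_n).

(** On the unit ball around [x] the function is bounded below because it is
    lower semicontinuous; a chord through [x] carries that bound outwards, where
    it grows at most linearly. *)
Lemma convex_lsc_linear_lower_bound g x :
  lower_semicontinuous g -> convex_efun g -> (forall z, g z != -oo%E) ->
  g x \is a fin_num ->
  exists C : R, forall d, 1 <= `|d| -> (g x - (C * `|d|)%:E <= g (x + d)%R)%E.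
Proof.
move=> lg cg gNy /fineK; move: (fine (g x)) => gx /esym gxE.
have A0 : [set u : 'rV[R]_n | `|u| <= 1] !=set0 by exists 0; rewrite /= normr0.
have lgx : lower_semicontinuous (fun d => g (x + d)).
  apply: (@lsc_comp _ _ _ g (fun d => x + d)) => // d.
  by apply: continuousD; [exact: cst_continuous|exact: cvg_id].
have [c Ac cmin] := lsc_compact_min lgx (@compact_norm_le R n 1) A0.
have [b bgc] : exists b : R, (b%:E <= g (x + c)%R)%E.
  have := gNy (x + c); case: (g (x + c)) => [r _|_|//]; first by exists r.
  by exists 0; rewrite leey.
exists (gx - b) => d d1; have d0 : 0 < `|d| by exact: lt_le_trans d1.
have t01 : 0 <= `|d|^-1 <= 1 by rewrite invr_ge0 normr_ge0 invf_le1.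
have := cg (x + d) x _ t01; rewrite gxE.
have -> : `|d|^-1 *: (x + d) + (1 - `|d|^-1) *: x = x + `|d|^-1 *: d.
  by rewrite scalerDr scalerBl scale1r addrC addrA subrK.
move=> /(le_trans (cmin _ _)) /(le_trans bgc) => H.
have {}H := H _.
move: H; rewrite /= normrZ normfV normr_id mulVf ?lt0r_neq0// => /(_ (lexx _)).
move: (gNy (x + d)); case: (g (x + d)) => [r _|_ _|//]; last by rewrite leey.
rewrite -!EFinM -!EFinD !lee_fin => H.
have -> : r = `|d| * (`|d|^-1 * r + (1 - `|d|^-1) * gx) - (`|d| - 1) * gx.
  by field; rewrite lt0r_neq0.
rewrite (_ : gx - _ = `|d| * b - (`|d| - 1) * gx); last by ring.
by rewrite lerB// ler_pM2l.
Qed.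

End ConvexLsc.

Section ProxExistence.
Context {R : realType} {m n : nat} (m_gt0 : (0 < m)%N).
Variables (f : 'I_m -> 'rV[R]_n -> R) (g : 'I_m -> 'rV[R]_n -> \bar R).
Hypothesis g_proper : forall i, proper_fun (g i).
Hypothesis g_lsc : forall i, lower_semicontinuous (g i).
Hypothesis g_convex : forall i, convex_efun (g i).
Implicit Types (x d : 'rV[R]_n) (l : R).

Lemma objF_gtNy i x : (-oo < objF f g i x)%E.
Proof.
by rewrite ltNye /objF adde_eq_ninfty /=; exact: (g_proper i).1.
Qed.

Lemma domF_fin x i : domF f g x -> g i x \is a fin_num.
Proof.
by move=> /(_ i); have := (g_proper i).1 x; rewrite /objF; case: (g i x).
Qed.

Lemma domF_segment x y (t : R) : domF f g x -> domF f g y -> 0 <= t <= 1 ->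
  domF f g (t *: x + (1 - t) *: y).
Proof.
move=> dx dy t01 i; rewrite /objF lte_add_pinfty ?ltry//.
apply: (le_lt_trans (g_convex i x y t01)).
by rewrite -(fineK (domF_fin i dx)) -(fineK (domF_fin i dy)) -!EFinM -EFinD ltry.
Qed.

Lemma prox_obj0 l x : domF f g x -> prox_obj f g l x 0 = 0%E.
Proof.
move=> dx; rewrite /prox_obj (_ : enorm 0 = 0) ?expr0n ?mulr0 ?adde0.
  apply/eqP; rewrite eq_le; apply/andP; split.
    apply/bigmax_leP; split; first by rewrite leNye.
    move=> i _; rewrite addr0 -(fineK (domF_fin i dx)) -EFinN -!EFinD lee_fin.
    by rewrite dotv0r add0r subrr.
  apply: le_trans (le_bigmax _ _ (Ordinal m_gt0)).
  rewrite addr0 -(fineK (domF_fin _ dx)) -EFinN -!EFinD lee_fin.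
  by rewrite dotv0r add0r subrr.
by rewrite -(scale0r 0) enormZ normr0 mul0r.
Qed.

Lemma lsc_prox_obj l x : domF f g x -> lower_semicontinuous (prox_obj f g l x).
Proof.
move=> dx.
apply: (@lsc_addr_continuous _ _ _ (fun d => l / 2 * enorm d ^+ 2)); last first.
  move=> d; apply: (@continuousM R _ (cst (l / 2)) (fun d => enorm d ^+ 2)).
    exact: cst_continuous.
  exact: continuous_enorm_sqr.
apply: lsc_bigmax => i; rewrite -(fineK (domF_fin i dx)).
under eq_fun do rewrite addeC addeA -EFinN -EFinD addeC.
apply: (@lsc_addr_continuous _ _ (fun d => g i (x + d))
  (fun d => - fine (g i x) + dotv (grad (f i) x) d)).
  apply: (@lsc_comp _ _ _ (g i) (fun d => x + d)) => // d.
  by apply: continuousD; [exact: cst_continuous|exact: cvg_id].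
move=> d.
apply: (@continuousD R R^o _ (cst (- fine (g i x))) (dotv (grad (f i) x))).
  exact: cst_continuous.
exact: continuous_dotv.
Qed.

(** One component of the maximum is enough: its linear lower bound is beaten
    far away by the quadratic term. *)
Lemma prox_obj_ge0_far l x : 0 < l -> domF f g x ->
  exists r : R, forall d, r < `|d| -> (0 <= prox_obj f g l x d)%E.
Proof.
move=> l0 dx; pose i0 := Ordinal m_gt0.
have [C hC] := convex_lsc_linear_lower_bound (@g_lsc i0) (@g_convex i0)
  (g_proper i0).1 (domF_fin i0 dx).
pose G := \sum_j `|grad (f i0) x ord0 j|.
exists (Num.max 1 (2 * (C + G) / l)) => d; rewrite gt_max => /andP[d1 dr].
have d0 : 0 < `|d| by exact: lt_trans d1.
have := hC d (ltW d1); have := dotv_ge_norm (grad (f i0) x) d; rewrite -/G.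
have hq : l / 2 * `|d| ^+ 2 <= l / 2 * enorm d ^+ 2.
  rewrite ler_wpM2l ?divr_ge0 ?(ltW l0)//.
  by rewrite lerXn2r ?nnegrE ?enorm_ge0 ?norm_le_enorm.
move=> hdot hg; rewrite /prox_obj.
apply: (@le_trans _ _ ((- (G * `|d|) - C * `|d|)%:E + (l / 2 * `|d| ^+ 2)%:E)%E).
  rewrite -EFinD lee_fin; move: dr; rewrite ltr_pdivrMr// => dr.
  rewrite (_ : _ + _ = `|d| / 2 * (`|d| * l - 2 * (C + G))); last by field.
  by rewrite mulr_ge0 ?divr_ge0 ?subr_ge0// ltW.
apply: leeD; last by rewrite lee_fin.
apply: le_trans (le_bigmax _ _ i0).
rewrite EFinB -(fineK (domF_fin i0 dx)) in hg *; move: hg.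
case: (g i0 (x + d)) => [s| |]; rewrite ?leey// -!EFinD !lee_fin.
by move: hdot; lra.
Qed.

(** A minimizer over a large ball is a minimizer over the whole space, since the
    value 0 at the origin is not beaten outside the ball. *)
Lemma prox_obj_has_min l x : 0 < l -> domF f g x ->
  exists d, forall d', (prox_obj f g l x d <= prox_obj f g l x d')%E.
Proof.
move=> l0 dx; have [r hr] := prox_obj_ge0_far l0 dx.
pose A : set 'rV[R]_n := [set u | `|u| <= Num.max 0 r].
have A0 : A !=set0 by exists 0; rewrite /A /= normr0 le_max lexx.
have [d Ad dmin] :=
  lsc_compact_min (@lsc_prox_obj l x dx) (@compact_norm_le R n _) A0.
exists d => d'; have [d'r|rd'] := leP `|d'| (Num.max 0 r); first exact: dmin.
apply: le_trans (hr d' _); last by rewrite (le_lt_trans _ rd')// le_max lexx orbT.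
rewrite -(prox_obj0 l dx); apply: dmin.
by rewrite /A /= normr0 le_max lexx.
Qed.

Lemma dirl_min l x d : 0 < l -> domF f g x ->
  (prox_obj f g l x (dirl f g l x) <= prox_obj f g l x d)%E.
Proof.
by move=> l0 dx; have := getPex (prox_obj_has_min l0 dx); exact.
Qed.

End ProxExistence.

(** * One step of the method *)

Section AlgorithmStep.
Context {R : realType} {m n : nat} (m_gt0 : (0 < m)%N).
Variables (f : 'I_m -> 'rV[R]_n -> R) (g : 'I_m -> 'rV[R]_n -> \bar R).
Variables nu M : 'I_m -> R.
Hypothesis f_smooth : forall i, continuously_differentiable (f i).
Hypothesis g_proper : forall i, proper_fun (g i).
Hypothesis g_lsc : forall i, lower_semicontinuous (g i).
Hypothesis g_convex : forall i, convex_efun (g i).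
Hypothesis nu_itv : forall i, 0 < nu i <= 1.
Hypothesis M_gt0 : forall i, 0 < M i.
Hypothesis f_holder : forall i x y, domF f g x -> domF f g y ->
  enorm (grad (f i) x - grad (f i) y) <= M i * enorm (x - y) `^ nu i.
Implicit Types (x d : 'rV[R]_n) (l eps : R).

(** With [d = y - x], the function maximized in [meritw] is the opposite of
    [prox_obj]. *)
Lemma meritw_le_opp_prox_obj l x : 0 < l -> domF f g x ->
  (meritw f g l x <= - prox_obj f g l x (dirl f g l x))%E.
Proof.
move=> l0 dx; apply: ge_ereal_sup => _ [y _ <-].
have dmin := dirl_min m_gt0 g_proper g_lsc g_convex (y - x) l0 dx.
rewrite leeNr; apply: (le_trans dmin).
rewrite /prox_obj oppeB ?fin_num_adde_defl// leeD2r//.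
apply/bigmax_leP; split; first by rewrite leNye.
move=> i _; rewrite leeNr; apply: (@bigmin_inf _ _ _ _ i) => //.
rewrite subrKC !dotvBr -(fineK (domF_fin g_proper i dx)).
case: (g i y) ((g_proper i).1 y) => [r _| |] //.
by rewrite -!(EFinN, EFinD) lee_fin; lra.
Qed.

(** Backtracking terminates: above the thresholds, the descent bound at the
    minimizing direction, with its Holder term absorbed by the quadratic term
    of the model, is the acceptance test. *)
Lemma accepted_of_ge_threshold eps l x : 0 < eps -> 0 < l -> domF f g x ->
  (forall i, holder_threshold (nu i) (M i) eps <= l) -> accepted f g eps l x.
Proof.
move=> eps0 l0 dx Ll i; set d := dirl f g l x.
have prox0 : (prox_obj f g l x d <= 0)%E.
  by rewrite -(prox_obj0 m_gt0 g_proper l dx) dirl_min.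
have le_prox j : ((dotv (grad (f j) x) d)%:E + g j (x + d) - g j x
    + (l / 2 * enorm d ^+ 2)%:E <= prox_obj f g l x d)%E.
  by rewrite /prox_obj leeD2r//; exact: le_bigmax.
have dxd : domF f g (x + d).
  move=> j; have := le_trans (le_prox j) prox0.
  rewrite /objF -(fineK (domF_fin g_proper j dx)).
  by have := (g_proper j).1 (x + d); case: (g j (x + d)) => // r _ _; rewrite ltry.
have wle : (prox_obj f g l x d <= - meritw f g l x)%E.
  by rewrite leeNr meritw_le_opp_prox_obj.
apply: le_trans (leeD wle (lexx _)); apply: le_trans (leeD (le_prox i) (lexx _)).
rewrite /objF -(fineK (domF_fin g_proper i dx)) -(fineK (domF_fin g_proper i dxd)).
rewrite -!EFinN -!EFinD lee_fin.
have [nu0 _] := andP (nu_itv i).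
have hdesc : f i (x + d) - f i x <=
    dotv (grad (f i) x) d + M i / (1 + nu i) * enorm d `^ (1 + nu i).
  apply: holder_descent => //; first exact: (f_smooth i).1.
  move=> t /andP[t0 t1]; apply: le_trans (f_holder i _ dx) _; last first.
    by rewrite [x + _]addrC addrK.
  rewrite (_ : x + t *: d = t *: (x + d) + (1 - t) *: x).
    by apply: domF_segment => //; rewrite !ltW.
  by rewrite scalerDr scalerBl scale1r [RHS]addrC addrA subrK.
have hquad := holder_le_quadratic (nu_itv i) (M_gt0 i) eps0 l0 (enorm_ge0 d) (Ll i).
by move: hdesc hquad; lra.
Qed.

(** If [l * w > eps], the slack [eps / (2 * l)] of the acceptance test takes
    back less than half of the guaranteed decrease [w > eps / l]. *)
Lemma accepted_decrease eps l x i : 0 < l -> domF f g x ->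
  accepted f g eps l x -> (eps%:E < l%:E * meritw f g l x)%E ->
  (objF f g i (x + dirl f g l x) + (eps / (2 * l))%:E < objF f g i x)%E.
Proof.
move=> l0 dx /(_ i); move: (x + dirl f g l x) => y.
have := objF_gtNy f g_proper i y; have := objF_gtNy f g_proper i x; have := dx i.
case: (objF f g i x) => [a| |]// _ _; case: (objF f g i y) => [b| |]// _.
  case: (meritw f g l x) => [w| |] //.
    rewrite -EFinM -!EFinN -!EFinD lee_fin !lte_fin => ba wl.
    have : eps / l < w by rewrite ltr_pdivrMr// mulrC.
    have -> : eps / l = eps / (2 * l) + eps / (2 * l) by field; rewrite gt_eqF.
    by move: ba; lra.
  by rewrite gt0_muleNy// lte_fin.
by case: (meritw f g l x) => [w| |] //; rewrite ?gt0_muleNy ?lte_fin.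
Qed.

End AlgorithmStep.

Section Backtracking.
Context {R : realType}.

Lemma trial_ge1 (lprev : R) j : 1 <= trial lprev j.
Proof.
by rewrite /trial -[leLHS]mulr1 ler_pM ?exprn_ege1 ?ler1n// le_max lexx.
Qed.

Lemma trialS (lprev : R) j : trial lprev j.+1 = 2 * trial lprev j.
Proof. by rewrite /trial exprS mulrA. Qed.

End Backtracking.

(** * The coefficient of the iteration bound *)

Section IterationBound.
Context {R : realType} {m : nat}.
Variables nu M : 'I_m -> R.
Hypothesis nu_itv : forall i, 0 < nu i <= 1.
Implicit Types lm eps : R.

Lemma iter_coef_ge_init lm eps : 2 * lm / eps <= iter_coef nu M lm eps.
Proof. exact: bigmax_ge_id. Qed.

Lemma iter_coef_ge_threshold lm eps i : 0 < eps ->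
  4 * holder_threshold (nu i) (M i) eps / eps <= iter_coef nu M lm eps.
Proof.
move=> eps0; have /andP[nu0 _] := nu_itv i.
by rewrite -holder_thresholdE//; apply: (le_bigmax _ _ i).
Qed.

Lemma iter_coef_gt0 lm eps : 0 < lm -> 0 < eps -> 0 < iter_coef nu M lm eps.
Proof.
move=> lm0 eps0; apply: lt_le_trans (iter_coef_ge_init _ _).
by rewrite divr_gt0 ?mulr_gt0.
Qed.

Lemma nu_min_itv : 0 < nu_min nu <= 1.
Proof.
rewrite /nu_min; apply/andP; split; last exact: bigmin_le_id.
by apply/bigmin_gtP; split => // i _; have /andP[] := nu_itv i.
Qed.

Lemma iter_exponent_ge1 (v : R) : 0 < v <= 1 -> 1 <= (1 + v) / (2 * v).
Proof. by move=> /andP[v0 v1]; rewrite ler_pdivlMr ?mulr_gt0//; lra. Qed.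

Lemma iter_exponent_le (v w : R) : 0 < v -> v <= w ->
  (1 + w) / (2 * w) <= (1 + v) / (2 * v).
Proof.
move=> v0 vw; have w0 : 0 < w by exact: lt_le_trans vw.
rewrite -subr_ge0 (_ : _ - _ = (w - v) / (2 * (v * w))).
  by rewrite divr_ge0 ?subr_ge0// !mulr_ge0// ltW.
by field; rewrite !lt0r_neq0.
Qed.

(** Below 1 a power of [eps] grows when its exponent decreases, and
    [(1 + v) / (2 * v)] is decreasing in [v] and at least 1, so that the term of
    the smallest exponent dominates all the others. *)
Lemma iter_coef_le_power lm : 0 <= lm ->
  exists C : R, forall eps, 0 < eps < 1 -> iter_coef nu M lm eps
    <= C * eps `^ (- ((1 + nu_min nu) / (2 * nu_min nu))).
Proof.
move=> lmge0.
pose c i := 4 * ((1 - nu i) / (1 + nu i)) `^ ((1 - nu i) / (2 * nu i))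
  * M i `^ (nu i)^-1.
exists (\big[Num.max/2 * lm]_(i < m) c i) => eps /andP[eps0 eps1].
set C := \big[_/_]_(i < m) _; set e := (1 + nu_min nu) / _.
have powN (a : R) : a <= e -> eps `^ (- a) <= eps `^ (- e).
  by move=> ae; rewrite ger_powR ?eps0 ?(ltW eps1)// lerN2.
have /andP[nm0 nm1] := nu_min_itv.
apply/bigmax_leP; split.
  rewrite -(powR_inv1 (ltW eps0)); apply: ler_pM; rewrite ?mulr_ge0 ?powR_ge0//.
    exact: bigmax_ge_id.
  by rewrite powN// iter_exponent_ge1// nm0.
move=> i _; have /andP[nu0 _] := nu_itv i.
rewrite mulrAC; apply: ler_pM; rewrite ?mulr_ge0 ?powR_ge0//.
  by apply: (le_bigmax _ c i).
by rewrite powN// iter_exponent_le// bigmin_le.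
Qed.

End IterationBound.

(** * Decrease along the iterations *)

Section Complexity.
Context {R : realType} {m n : nat} (m_gt0 : (0 < m)%N).
Variables (f : 'I_m -> 'rV[R]_n -> R) (g : 'I_m -> 'rV[R]_n -> \bar R).
Variables nu M : 'I_m -> R.
Hypothesis f_smooth : forall i, continuously_differentiable (f i).
Hypothesis g_proper : forall i, proper_fun (g i).
Hypothesis g_lsc : forall i, lower_semicontinuous (g i).
Hypothesis g_convex : forall i, convex_efun (g i).
Hypothesis nu_itv : forall i, 0 < nu i <= 1.
Hypothesis M_gt0 : forall i, 0 < M i.
Hypothesis f_holder : forall i x y, domF f g x -> domF f g y ->
  enorm (grad (f i) x - grad (f i) y) <= M i * enorm (x - y) `^ nu i.
Implicit Types (x : 'rV[R]_n) (l eps B : R).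

(** A first trial is 1 or half the previous value; a later one is twice a
    rejected value, and a rejected value lies below some Holder threshold. *)
Lemma backtracking_le eps lprev x j B : 0 < eps -> domF f g x ->
  1 <= B -> lprev / 2 <= B ->
  (forall i, 2 * holder_threshold (nu i) (M i) eps <= B) ->
  (forall j', (j' < j)%N -> ~ accepted f g eps (trial lprev j') x) ->
  trial lprev j <= B.
Proof.
move=> eps0 dx B1 lB thB; case: j => [_|j rej].
  by rewrite /trial expr0 mul1r ge_max B1.
rewrite leNgt trialS; apply/negP => Bl; apply: (rej j (ltnSn j)).
apply: (accepted_of_ge_threshold m_gt0 f_smooth g_proper g_lsc g_convex
  nu_itv M_gt0 f_holder) => //.
  exact: lt_le_trans (trial_ge1 _ _).
by move=> i; have := thB i; move: Bl; lra.
Qed.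

Lemma generated_decrease eps x0 lm xs ls k B i : 0 < eps ->
  generated f g eps x0 lm xs ls -> domF f g (xs k) ->
  ls k <= B -> (eps%:E < (ls k)%:E * meritw f g (ls k) (xs k))%E ->
  (objF f g i (xs k.+1) + (eps / (2 * B))%:E < objF f g i (xs k))%E.
Proof.
move=> eps0 [_ /(_ k)[j [lsE acc _ ->]]] dx lB wgt.
have ls0 : 0 < ls k by rewrite lsE; exact: lt_le_trans (trial_ge1 _ _).
apply: le_lt_trans (accepted_decrease g_proper i ls0 dx acc wgt) => //.
rewrite leeD2l// lee_fin ler_pM2l// lef_pV2 ?posrE ?mulr_gt0//.
  by rewrite ler_pM2l.
exact: lt_le_trans lB.
Qed.

(** As long as the tolerance is not met, all the objectives drop by
    [eps / (2 * B)] at every step, where [B] bounds the step parameters. The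
    bound is carried on the half of the previous parameter because that is what
    the next first trial depends on; this also accommodates [lm] at the
    start. *)
Lemma generated_invariant eps x0 lm xs ls K B : 0 < eps -> domF f g x0 ->
  generated f g eps x0 lm xs ls ->
  1 <= B -> lm / 2 <= B ->
  (forall i, 2 * holder_threshold (nu i) (M i) eps <= B) ->
  (forall k, (k < K)%N -> (eps%:E < (ls k)%:E * meritw f g (ls k) (xs k))%E) ->
  forall k, (k <= K)%N ->
    [/\ domF f g (xs k), prev_l lm ls k / 2 <= B &
      forall i, (objF f g i (xs k) + (k%:R * (eps / (2 * B)))%:E
                 <= objF f g i x0)%E].
Proof.
move=> eps0 dx0 gen B1 lB thB wgt; elim=> [_|k IH kK].
  have [-> _] := gen; split => // i.
  by rewrite mul0r adde0.
have [dx pB dec] := IH (ltnW kK).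
have lkB : ls k <= B.
  have [_ /(_ k)[j [-> _ rej _]]] := gen.
  exact: backtracking_le rej.
have stp i := generated_decrease i eps0 gen dx lkB (wgt k kK).
split.
- move=> i; have := stp i; have := dx i.
  case: (objF f g i (xs k)) => [a| |] //; case: (objF f g i (xs k.+1)) => [b| |] //.
  by move=> _ _; rewrite ltry.
- rewrite /= ler_pdivrMr//; move: lkB B1; lra.
- move=> i; apply: le_trans (dec i); rewrite -natr1 mulrDl mul1r EFinD.
  by rewrite addeA addeAC leeD2r// ltW.
Qed.

End Complexity.

(** * The complexity bound *)

Theorem theorem3p1 (R : realType) (m n : nat) (hm : (0 < m)%N) (hn : (0 < n)%N)
    (f : 'I_m -> 'rV[R]_n -> R) (g : 'I_m -> 'rV[R]_n -> \bar R)
    (nu M : 'I_m -> R)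
    (hf : forall i, continuously_differentiable (f i))
    (hg_proper : forall i, proper_fun (g i))
    (hg_lsc : forall i, lower_semicontinuous (g i))
    (hg_convex : forall i, convex_efun (g i))
    (hnu : forall i, 0 < nu i <= 1)
    (hM : forall i, 0 < M i)
    (hHolder : forall i x y, domF f g x -> domF f g y ->
       enorm (grad (f i) x - grad (f i) y) <= M i * enorm (x - y) `^ nu i)
    (x0 : 'rV[R]_n) (hx0 : domF f g x0)
    (lm1 : R) (hlm1 : 2 <= lm1) :
  (forall (eps : R) (xs : nat -> 'rV[R]_n) (ls : nat -> R),
     0 < eps ->
     generated f g eps x0 lm1 xs ls ->
     forall K : nat, (1 <= K)%N ->
       (iter_bound f g nu M x0 lm1 eps <= K%:R%:E)%E ->
       (\big[mine/+oo]_(k < K) ((ls k)%:E * meritw f g (ls k) (xs k))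
          <= eps%:E)%E) /\
  ((merit0 f g x0 < +oo)%E ->
     (fun eps : R => fine (iter_bound f g nu M x0 lm1 eps)) =O_ (0^'+)
     (fun eps : R => eps `^ (- ((1 + nu_min nu) / (2 * nu_min nu))))).
Proof.
have lm0 : 0 < lm1 by exact: lt_le_trans hlm1.
split.
- move=> eps xs ls eps0 gen [//|K] _ bound.
  rewrite leNgt; apply/negP => /bigmin_gtP[_ wgt].
  set T := iter_coef nu M lm1 eps.
  have T0 : 0 < T by exact: iter_coef_gt0.
  (* A uniform bound on the step parameters, chosen so that the decrease
     [eps / (2 * B)] of one step is [T^-1]. *)
  pose B := T * eps / 2.
  have lB : lm1 <= B.
    have := iter_coef_ge_init nu M lm1 eps; rewrite -/T ler_pdivrMr// /B; lra.
  have thB i : 2 * holder_threshold (nu i) (M i) eps <= B.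
    have := iter_coef_ge_threshold M hnu lm1 i eps0.
    by rewrite -/T ler_pdivrMr// /B; lra.
  have {}wgt k : (k < K.+1)%N ->
      (eps%:E < (ls k)%:E * meritw f g (ls k) (xs k))%E.
    by move=> kK; exact: (wgt (Ordinal kK)).
  have [||dx pB dec] := generated_invariant hm hf hg_proper hg_lsc hg_convex
    hnu hM hHolder eps0 hx0 gen _ _ thB wgt (leqnSn K); [lra|lra|].
  have lKB : ls K <= B.
    have [_ /(_ K)[j [-> _ rej _]]] := gen.
    apply: (backtracking_le hm hf hg_proper hg_lsc hg_convex hnu hM hHolder
      eps0 dx _ pB thB rej); lra.
  have cE : eps / (2 * B) = T^-1.
    by rewrite /B; field; rewrite !lt0r_neq0.
  (* Comparing with the last iterate bounds [merit0] from below; the last step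
     is taken apart to make the inequality strict. *)
  have gap : ((K.+1%:R / T)%:E < merit0 f g x0)%E.
    apply: (@lt_le_trans _ _ (\big[mine/+oo]_(i < m)
      (objF f g i x0 - objF f g i (xs K.+1)))%E); last first.
      by apply: ereal_sup_ubound; exists (xs K.+1).
    apply/bigmin_gtP; split; first by rewrite ltry.
    move=> i _.
    have stp := generated_decrease hg_proper i eps0 gen dx lKB (wgt K (ltnSn K)).
    rewrite cE in stp dec *.
    move: stp (dec i) (hx0 i) (objF_gtNy f hg_proper i (xs K.+1)).
    case: (objF f g i x0) => [a| |]//; case: (objF f g i (xs K)) => [b| |]//;
      case: (objF f g i (xs K.+1)) => [c| |]//.
    rewrite -!EFinN -!EFinD !lee_fin !lte_fin => cb ba _ _.
    by rewrite -natr1 mulrDl mul1r; lra.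
  move: bound; rewrite leNgt => /negP; apply; rewrite /iter_bound -/T.
  case: (merit0 f g x0) gap => [u| _|//]; last by rewrite gt0_muley ?lte_fin// ltey.
  by rewrite -EFinM !lte_fin ltr_pdivrMr// mulrC.
- move=> u_fin.
  have [C hC] := iter_coef_le_power M hnu (ltW lm0).
  apply/eqO_exP; exists (`|C| * `|fine (merit0 f g x0)| + 1).
    by rewrite ltr_wpDl ?mulr_ge0.
  near=> eps.
  have eps01 : 0 < eps < 1 by apply/andP; split; near: eps;
    [exact: nbhs_right_gt|exact: nbhs_right_lt].
  have /andP[eps0 _] := eps01.
  have T0 := iter_coef_gt0 nu M lm0 eps0.
  have -> : fine (iter_bound f g nu M x0 lm1 eps)
      = iter_coef nu M lm1 eps * fine (merit0 f g x0).
    rewrite /iter_bound; case: (merit0 f g x0) u_fin => [u| |]//= _.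
    by rewrite gt0_muleNy ?lte_fin//= mulr0.
  rewrite normrM (gtr0_norm T0) (ger0_norm (powR_ge0 _ _)).
  set p := eps `^ _; have p0 : 0 <= p := powR_ge0 _ _.
  apply: (@le_trans _ _ (`|C| * p * `|fine (merit0 f g x0)|)).
    by rewrite ler_wpM2r// (le_trans (hC _ eps01))// ler_wpM2r// ler_norm.
  by rewrite mulrAC ler_wpM2r// lerDl.
Unshelve. all: by end_near. Qed.
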